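(* For every integer $m\ge1$, the lattice $L(m)\subseteq\mathbb Z^4$ generated by $(m+4,-(m+1),-1,-1)$, $(-(m+1),-3,-1,m+4)$ and $(-1,m+3,-(m+1),-1)$ is positive.
   Context: A lattice (subgroup) $L\subseteq\mathbb Z^r$ is positive if $L\cap\mathbb N^r=\{\mathbf 0\}$, where $\mathbb N$ includes $0$. *)

(* Defs.v *)
From mathcomp Require Import all_boot all_order all_algebra.

Set Implicit Arguments.
Unset Strict Implicit.
Unset Printing Implicit Defensive.

Import Order.TTheory GRing.Theory Num.Theory.
Local Open Scope ring_scope.

Definition is_lattice (r : nat) (L : 'rV[int]_r -> Prop) : Prop :=
  L 0 /\ forall u v, L u -> L v -> L (u - v).

Definition positive_lattice (r : nat) (L : 'rV[int]_r -> Prop) : Prop :=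
  is_lattice L /\
  forall v : 'rV[int]_r, (L v /\ forall i, 0 <= v ord0 i) <-> v = 0.

Definition vec4 (a b c d : int) : 'rV[int]_4 :=
  \row_(j < 4) [:: a; b; c; d]`_j.

Definition Lm (m : int) : 'rV[int]_4 -> Prop :=
  inIntSpan [tuple vec4 (m + 4) (- (m + 1)) (-1) (-1);
                   vec4 (- (m + 1)) (-3) (-1) (m + 4);
                   vec4 (-1) (m + 3) (- (m + 1)) (-1)].

(* Main.v *)
(** The cofactors of the generator matrix of [L(m)] are, up to a common sign,
    polynomials in [m] with positive coefficients.  They form a vector [w] with
    positive entries that is orthogonal to [L(m)], and the only non-negative
    vector orthogonal to such a [w] is [0]. *)
Require Import Defs.
From mathcomp Require Import all_boot all_order all_algebra.
From mathcomp Require Import ring lra.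

Import Order.TTheory GRing.Theory Num.Theory.

Local Open Scope ring_scope.

Lemma inIntSpan_is_lattice (r n : nat) (s : n.-tuple 'rV[int]_r) :
  is_lattice (inIntSpan s).
Proof.
split; first by exists [ffun=> 0]; rewrite big1 // => i _; rewrite ffunE mulr0z.
move=> u v [a ->] [b ->]; exists [ffun i => a i - b i].
by rewrite -sumrB; apply: eq_bigr => i _; rewrite ffunE mulrzBr.
Qed.

Lemma inIntSpan_orthogonal (r n : nat) (s : n.-tuple 'rV[int]_r)
    (w : 'cV[int]_r) :
  (forall i : 'I_n, s`_i *m w = 0) -> forall v, inIntSpan s v -> v *m w = 0.
Proof.
move=> sw0 v [a ->]; rewrite mulmx_suml big1 // => i _.
by rewrite -scaler_int -scalemxAl sw0 scaler0.
Qed.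

(** The single entry of [v *m w] is a sum of non-negative terms, so each term vanishes, and its
    positive weight cancels. *)
Lemma nonneg_orthogonal_eq0 (r : nat) (w : 'cV[int]_r) (v : 'rV[int]_r) :
  (forall i, 0 < w i ord0) -> (forall i, 0 <= v ord0 i) -> v *m w = 0 -> v = 0.
Proof.
move=> w_gt0 v_ge0 /matrixP/(_ ord0 ord0); rewrite !mxE => vw0.
have vw_ge0 i : true -> 0 <= v ord0 i * w i ord0.
  by rewrite mulr_ge0 // ltW.
apply/rowP => i; rewrite mxE; apply/eqP.
have /eqP := psumr_eq0P vw_ge0 vw0 (erefl true : xpredT i).
by rewrite mulf_eq0 (gt_eqF (w_gt0 i)) orbF.
Qed.

Lemma positive_inIntSpan (r n : nat) (s : n.-tuple 'rV[int]_r)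
    (w : 'cV[int]_r) :
  (forall i, 0 < w i ord0) -> (forall i : 'I_n, s`_i *m w = 0) ->
  positive_lattice (inIntSpan s).
Proof.
move=> w_gt0 sw0; have Ls := inIntSpan_is_lattice _ _ s; split=> // v; split.
  case=> sv v_ge0; apply: (nonneg_orthogonal_eq0 _ _ _ w_gt0 v_ge0).
  exact: inIntSpan_orthogonal sw0 _ sv.
by move=> ->; split; [case: Ls | move=> i; rewrite mxE].
Qed.

(** The signed maximal minors of the generator matrix: pairing them with a generator expands, up to
    sign, a determinant with a repeated row. *)
Definition Lm_weight (m : int) : 'cV[int]_4 :=
  (vec4 (m ^+ 3 + 7 * m ^+ 2 + 21 * m + 20)
        (m ^+ 3 + 8 * m ^+ 2 + 25 * m + 25)
        (m ^+ 3 + 8 * m ^+ 2 + 26 * m + 25)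
        (m ^+ 3 + 8 * m ^+ 2 + 28 * m + 30))^T.

Lemma Lm_weight_gt0 (m : int) : 0 <= m -> forall i, 0 < Lm_weight m i ord0.
Proof.
move=> m_ge0; have m2_ge0 := exprn_ge0 2 m_ge0; have m3_ge0 := exprn_ge0 3 m_ge0.
(* Each entry is linear in [m], [m ^+ 2], [m ^+ 3], with positive constant term. *)
by case=> [[|[|[|[|i]]]] // lti]; rewrite !mxE /=; lra.
Qed.

Theorem proposition3p5 (m : int) (hm : 1 <= m) : positive_lattice (Lm m).
Proof.
apply: (positive_inIntSpan _ _ _ (Lm_weight m)).
  exact/Lm_weight_gt0/(le_trans ler01 hm).
(* For each of the three generators, orthogonality is a polynomial identity in [m]. *)
case=> [[|[|[|i]]] // lti]; apply/matrixP => j k;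
  by rewrite !mxE !big_ord_recl big_ord0 !mxE /=; ring.
Qed.
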